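(* Let $D=(\alpha_1(D),\dots,\alpha_\ell(D))\notin\mathfrak B$ be a connected ribbon with an odd number of boxes, odd length $\ell$, and $\alpha_1(D)=1$. Let $k$ and $m$ be the head length and tail length of $D$. Then $\mathfrak r_D$ is not $p$-positive in each of the following cases: (a) $\alpha_\ell(D)>1$ and $k$ is even; (b) $\alpha_\ell(D)>1$, $k$ is odd and $m$ is even; (c) $\alpha_\ell(D)=1$ and $k=m$.
   Context: A connected ribbon $D$ of composition $(\alpha_1(D),\dots,\alpha_\ell(D))$ has $\alpha_r(D)$ consecutive boxes in row $r$ (rows numbered top to bottom), with the leftmost box of row $r$ directly above the rightmost box of row $r+1$; $\ell$ is its length. The head length of $D$ is the smallest index $i$ such that row $i$ contains at least two boxes. The tail length of $D$ is: if $\alpha_\ell(D)=1$, the smallest $j$ such that row $\ell-j+1$ contains at least two boxes; otherwise $\alpha_\ell(D)$. $D^t$ is the transpose and $D^\circ$ the rotation by 180 degrees. $\mathfrak r_D=\sum_T x^{c(T)}$ over fillings $T$ of $D$ with letters of $\{1'<1<2'<2<\cdots\}$ having rows and columns weakly increasing, at most one unmarked $k$ per column and at most one marked $k'$ per row; $c(T)_i$ counts entries $i$ or $i'$. $\triangle_{n,k}$ is the ribbon of composition $(1^{k-1},n-k+1)$; $\mathfrak B=\bigcup_n\mathfrak B_n$ with $\mathfrak B_n=\{\triangle_{n,1},\triangle_{n,1}^t,\triangle_{n,3},\triangle_{n,3}^t,\triangle_{n,3}^\circ,(\triangle_{n,3}^t)^\circ\}$ (only the first two when $n\le 2$). A symmetric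 function is $p$-positive if all its coefficients in the power sum basis are nonnegative. *)

(* Defs.v *)
From HB Require Import structures.
From mathcomp Require Import all_boot all_order all_algebra.
Set Implicit Arguments. Unset Strict Implicit. Unset Printing Implicit Defensive.
Import Order.TTheory GRing.Theory Num.Theory.

(* A connected ribbon is given by its composition a = (alpha_1,...,alpha_l),
   a nonempty sequence of positive integers.  Rows are numbered 0..l-1 top
   to bottom; row r occupies columns s r, ..., s r + alpha_{r+1} - 1 where
   s r = sum_{j > r} (alpha_j - 1), so that the leftmost box of row r lies
   directly above the rightmost box of row r+1 (bottom row starts at col 0). *)
Definition rstart (a : seq nat) (r : nat) : nat :=
  sumn [seq x.-1 | x <- drop r.+1 a].

Definition cells (a : seq nat) : seq (nat * nat) :=
  flatten [seq [seq (r, rstart a r + j) | j <- iota 0 (nth 0 a r)]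
          | r <- iota 0 (size a)].

Definition is_composition (a : seq nat) : bool :=
  (a != [::]) && all (fun x => 0 < x) a.

(* Letters 1' < 1 < 2' < 2 < ... are coded by naturals:
   k' |-> 2(k-1),  k |-> 2(k-1)+1.  Unmarked <-> odd code;
   the (0-indexed) variable of code v is v./2. *)
Definition cell_of (a : seq nat) (i : nat) : nat * nat := nth (0, 0) (cells a) i.

Definition valid_filling (a : seq nat) (T : nat -> nat) : bool :=
  [forall i : 'I_(sumn a), forall j : 'I_(sumn a),
    let ci := cell_of a i in let cj := cell_of a j in
    [&& ((ci.1 == cj.1) && (ci.2 < cj.2)) ==> (T i <= T j),
        ((ci.2 == cj.2) && (ci.1 < cj.1)) ==> (T i <= T j),
        [&& i != j, ci.2 == cj.2 & T i == T j] ==> ~~ odd (T i)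
      &
        [&& i != j, ci.1 == cj.1 & T i == T j] ==> odd (T i)]].

(* coefficient of x^mu (mu in N^nv) in r_D restricted to nv variables *)
Definition rcoef (a : seq nat) (nv : nat) (mu : 'I_nv -> nat) : nat :=
  #|[set T : {ffun 'I_(sumn a) -> 'I_(2 * nv)} |
      valid_filling a (fun i => if insub i is Some i' then val (T i') else 0)
      && [forall v : 'I_nv, #|[set k | (val (T k))./2 == val v]| == mu v]]|.

Arguments rcoef a nv mu : clear implicits.

(* coefficient of x^mu in the power sum p_lambda in nv variables *)
Definition pcoef (lam : seq nat) (nv : nat) (mu : 'I_nv -> nat) : nat :=
  #|[set f : {ffun 'I_(size lam) -> 'I_nv} |
      [forall v : 'I_nv, \sum_(j | f j == v) nth 0 lam j == mu v]]|.

Arguments pcoef lam nv mu : clear implicits.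

Definition is_partition_of (n : nat) (lam : seq nat) : bool :=
  [&& sorted geq lam, all (fun x => 0 < x) lam & sumn lam == n].

(* r_D is p-positive: it equals (as a symmetric function, i.e. in every
   finite number of variables) a nonnegative rational combination of power
   sums p_lambda, lambda a partition of |D|. *)
Definition r_p_positive (a : seq nat) : Prop :=
  exists L : seq (seq nat * rat),
    (forall x, x \in L -> is_partition_of (sumn a) x.1 /\ (0 <= x.2)%R) /\
    forall (nv : nat) (mu : 'I_nv -> nat),
      ((rcoef a nv mu)%:R = \sum_(x <- L) x.2 * (pcoef x.1 nv mu)%:R)%R.

Definition head_len (a : seq nat) : nat := (find (fun x => 1 < x) a).+1.

Definition tail_len (a : seq nat) : nat :=
  if last 0 a == 1 then (find (fun x => 1 < x) (rev a)).+1 else last 0 a.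

Definition ribbon_transpose (a : seq nat) : seq nat :=
  [seq count (fun x => x.2 == c) (cells a) | c <- iota 0 (sumn a - size a).+1].

Definition ribbon_rot (a : seq nat) : seq nat := rev a.

Definition tri (n k : nat) : seq nat := nseq k.-1 1 ++ [:: n - k + 1].

Definition in_B (a : seq nat) : Prop :=
  exists n : nat, 0 < n /\
    (a = tri n 1 \/ a = ribbon_transpose (tri n 1) \/
     (2 < n /\ (a = tri n 3 \/ a = ribbon_transpose (tri n 3) \/
                a = ribbon_rot (tri n 3) \/
                a = ribbon_rot (ribbon_transpose (tri n 3))))).

(* Main.v *)
(* Read along the ribbon from its bottom-left box, the filling conditions on two
   consecutive boxes are complementary for steps right and steps up.  Hence r_D
   is a sum over words with a prescribed descent set, one has
   r_(b1 up b2) + r_(b1 right b2) = r_b1 r_b2, and a row of length m gives the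
   coefficient q_m of prod (1 + x t) / (1 - x t) = exp (2 sum_(m odd) p_m t^m / m).
   For odd i, j, k with i + j + k = n, inclusion-exclusion then gives the
   coefficient of p_i p_j p_k in r_D: up to a positive factor and the sign
   (-1)^(l-1), it is (1 - F)(1 - G) - H, where S is the set of partial sums of
   the composition, F (resp. G) counts the parts x among i, j, k with x
   (resp. n - x) in S, and H those with both.  It is negative for the parts
   (1, k-1, n-k) in case (a) and in case (c) with k even, for (1, m-1, n-m) in
   case (b), and for (1, k, n-k-1) in case (c) with k odd.

   The coefficient is detected without inverting the power sum basis: on the
   alphabet s mu_i, t mu_j, u mu_k (mu_n the n-th roots of unity) every power sum
   has nonnegative coefficients in s, t, u, whereas the coefficient of
   s^i t^j u^k in r_D is (-1)^(l-1) 8 ((1 - F)(1 - G) - H). *)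
Require Import Defs.
From HB Require Import structures.
From mathcomp Require Import all_boot all_order all_algebra.
From mathcomp Require Import perm all_field zify ring lra.
Set Implicit Arguments. Unset Strict Implicit. Unset Printing Implicit Defensive.
Import Order.TTheory GRing.Theory Num.Theory.

(** * Fillings and walks along the ribbon *)

Local Open Scope nat_scope.

(* With k' coded by 2(k-1) and k by 2(k-1)+1, this is the condition on two
   horizontally adjacent letters; its negation is exactly the condition on two
   vertically adjacent ones (read upwards). *)
Definition asc (u v : nat) : bool := (u < v)%N || ((u == v) && odd u).

(* The steps of the walk along the ribbon from its bottom-left box, [true] being
   a step up; the artificial first [true] makes the positions of [true] exactly
   the proper partial sums (including 0) of the composition read backwards. *)
Definition steps (a : seq nat) : seq bool :=
  flatten [seq true :: nseq x.-1 false | x <- rev a].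

Lemma steps_cat a b : steps (a ++ b) = steps b ++ steps a.
Proof. by rewrite /steps rev_cat map_cat flatten_cat. Qed.

Lemma steps_cons x a : steps (x :: a) = steps a ++ true :: nseq x.-1 false.
Proof. by rewrite -cat1s steps_cat /steps /= cats0. Qed.

Lemma size_steps a : all (fun x => 0 < x) a -> size (steps a) = sumn a.
Proof.
elim: a => [|x a IH] //= /andP[x0 /IH h].
by rewrite steps_cons size_cat /= size_nseq h; lia.
Qed.

Lemma count_steps a : count id (steps a) = size a.
Proof.
elim: a => [|x a IH] //=.
by rewrite steps_cons count_cat /= count_nseq IH; lia.
Qed.

(** The artificial first [true] is counted in h, so h is the number of rows entered so far and p + 1
    - h the number of steps right: box 0 lies in row [size a - 1], column 0. *)
Definition path_cell (a : seq nat) (p : nat) : nat * nat :=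
  let h := count id (take p.+1 (steps a)) in (size a - h, p.+1 - h).

Lemma sumn_pred a : all (fun x => 0 < x) a ->
  sumn [seq x.-1 | x <- a] = sumn a - size a /\ size a <= sumn a.
Proof.
elim: a => [|x a IH] //= /andP[x0 /IH [-> h]]; lia.
Qed.

Lemma cells_cons x a : 
  cells (x :: a) = [seq (0, rstart (x :: a) 0 + j) | j <- iota 0 x]
    ++ [seq (c.1.+1, c.2) | c <- cells a].
Proof.
rewrite /cells /=; congr (_ ++ _).
rewrite map_flatten -map_comp -(addn0 1) iotaDl -map_comp; congr flatten.
apply: eq_map => r /=; rewrite -map_comp; apply: eq_map => j /=.
by rewrite add1n.
Qed.

(** [cells] starts with the top row and the walk with the bottom row, hence only a permutation. In
    the induction a new top row prolongs the walk at its end. *)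
Lemma perm_cells a : all (fun x => 0 < x) a ->
  perm_eq (cells a) [seq path_cell a p | p <- iota 0 (sumn a)].
Proof.
elim: a => [|x a IH] //= /andP[x0 ha].
have [hp hs] := sumn_pred ha.
have eq_perm (s t : seq (nat * nat)) : s = t -> perm_eq s t by move=> ->.
rewrite cells_cons perm_catC addnC iotaD map_cat; apply: perm_cat.
  rewrite (perm_trans (perm_map _ (IH ha))) // -map_comp.
  apply: eq_perm; apply/eq_in_map => p.
  rewrite mem_iota add0n => /andP[_ lt_p] /=.
  rewrite /path_cell /= steps_cons takel_cat ?size_steps //.
  have : count id (take p.+1 (steps a)) <= count id (steps a).
    by rewrite -{2}(cat_take_drop p.+1 (steps a)) count_cat leq_addr.
  by rewrite count_steps => hc; congr pair; lia.
rewrite add0n -[sumn a]addn0 iotaDl -map_comp.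
apply: eq_perm; apply/eq_in_map => j.
rewrite mem_iota add0n => /andP[_ lt_j] /=.
rewrite /path_cell /= steps_cons /rstart /= drop0 hp.
rewrite take_cat size_steps // ifF; last by lia.
rewrite count_cat count_steps (_ : (sumn a + j).+1 - sumn a = j.+1) /=; last by lia.
rewrite take_nseq; last by lia.
by rewrite count_nseq /=; congr pair; lia.
Qed.

Lemma asc_trans : transitive asc.
Proof. by move=> v u w; rewrite /asc; lia. Qed.

(** With [asc] and its complement both transitive, conditions on neighbouring boxes propagate along
    whole rows and columns. *)
Lemma desc_trans u v w : ~~ asc v u -> ~~ asc w v -> ~~ asc w u.
Proof. by rewrite /asc; lia. Qed.

Section Chains.
Variables (B : seq bool) (w : nat -> nat).
Let rho p := count id (take p.+1 B).
Hypothesis local : forall p, p.+1 < size B -> asc (w p) (w p.+1) (+) nth false B p.+1.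

Lemma rhoS p : p.+1 < size B -> rho p.+1 = nth false B p.+1 + rho p.
Proof.
move=> h; rewrite /rho (take_nth false h) -cats1 count_cat /= addn0 addnC.
by [].
Qed.

Lemma rho_homo p q : p + q < size B -> rho p <= rho (p + q) <= rho p + q.
Proof.
elim: q => [|q IH]; first by rewrite addn0; lia.
by rewrite addnS => h; rewrite rhoS //; move: (IH (ltnW h)); lia.
Qed.

Lemma row_chain p q : p + q.+1 < size B -> rho (p + q.+1) = rho p ->
  asc (w p) (w (p + q.+1)).
Proof.
elim: q => [|q IH].
  rewrite addn1 => h; rewrite rhoS // => e; move: (local h).
  by rewrite (_ : nth _ _ _ = false) ?addbF //; lia.
rewrite addnS => h; rewrite rhoS // => e.
have := rho_homo (ltnW h) => e2.
apply: (@asc_trans (w (p + q.+1))); first by apply: IH; lia.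
by move: (local h); rewrite (_ : nth _ _ _ = false) ?addbF //; lia.
Qed.

Lemma col_chain p q : p + q.+1 < size B -> rho (p + q.+1) = rho p + q.+1 ->
  ~~ asc (w p) (w (p + q.+1)).
Proof.
elim: q => [|q IH].
  rewrite addn1 => h; rewrite rhoS // => e; move: (local h).
  by rewrite (_ : nth _ _ _ = true) ?addbT //; lia.
rewrite addnS => h; rewrite rhoS // => e.
have := rho_homo (ltnW h) => e2.
apply: (@desc_trans _ (w (p + q.+1))); last by apply: IH; lia.
by move: (local h); rewrite (_ : nth _ _ _ = true) ?addbT //; lia.
Qed.
End Chains.

Definition valid_pair (ci cj : nat * nat) (ne : bool) (ti tj : nat) : bool :=
    [&& ((ci.1 == cj.1) && (ci.2 < cj.2)) ==> (ti <= tj),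
        ((ci.2 == cj.2) && (ci.1 < cj.1)) ==> (ti <= tj),
        [&& ne, ci.2 == cj.2 & ti == tj] ==> ~~ odd ti
      &
        [&& ne, ci.1 == cj.1 & ti == tj] ==> odd ti].

(** Boxes of one row are joined by right steps only and boxes of one column by up steps only, so
    [row_chain] and [col_chain] recover all pairs. Conversely, the clauses for two neighbouring
    boxes decide whether [asc] holds between them. *)
Lemma path_pairP a (w : nat -> nat) : all (fun x => 0 < x) a ->
  (forall p q, p < sumn a -> q < sumn a ->
     valid_pair (path_cell a p) (path_cell a q) (p != q) (w p) (w q)) <->
  (forall p, p.+1 < sumn a -> asc (w p) (w p.+1) (+) nth false (steps a) p.+1).
Proof.
move=> ha; rewrite -(size_steps ha).
have hB p : count id (take p.+1 (steps a)) <= size a.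
  by rewrite -count_steps -{2}(cat_take_drop p.+1 (steps a)) count_cat leq_addr.
have hp p : count id (take p.+1 (steps a)) <= p.+1.
  by rewrite (leq_trans (count_size _ _)) // size_take; case: ltnP => //; lia.
split=> [h p hlt|h p q ltp ltq].
  have := h _ _ (ltnW hlt) hlt; have := h _ _ hlt (ltnW hlt).
  rewrite /valid_pair /path_cell /=.
  move: (hB p) (hB p.+1) (hp p) (hp p.+1); rewrite rhoS //.
  move: (count _ _) (w p) (w p.+1) => r u v; rewrite /asc.
  case: (nth _ _ _) => /= r1 r2 r3 r4.
    rewrite addbT => /and4P[_ /implyP h2 _ _] /and4P[_ _ /implyP h3 _].
    have {}h2 : v <= u by apply: h2; lia.
    have {}h3 : u = v -> ~~ odd u by move=> e; apply: h3; lia.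
    by clear - h2 h3; lia.
  rewrite addbF => _ /and4P[/implyP h1 _ _ /implyP h4].
  have {}h1 : u <= v by apply: h1; lia.
  have {}h4 : u = v -> odd u by move=> e; apply: h4; lia.
  by clear - h1 h4; lia.
have key p' q' : p' < q' -> q' < size (steps a) ->
   valid_pair (path_cell a p') (path_cell a q') true (w p') (w q') /\
   valid_pair (path_cell a q') (path_cell a p') true (w q') (w p').
  move=> lt1 lt2; have := row_chain h (p := p') (q := q' - p'.+1).
  have := col_chain h (p := p') (q := q' - p'.+1).
  have := rho_homo (B := steps a) (p := p') (q := q' - p').
  rewrite /valid_pair /path_cell /=.
  rewrite (_ : p' + (q' - p'.+1).+1 = q'); last by lia.
  rewrite (_ : p' + (q' - p') = q'); last by lia.
  move: (hB p') (hB q') (hp p') (hp q').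
  move: (count id (take p'.+1 _)) (count id (take q'.+1 _)) => r1 r2.
  move=> r1B r2B r1p r2p /(_ lt2) /andP[le1 le2] /(_ lt2) col /(_ lt2) row.
  have {}row : r2 = r1 -> asc (w p') (w q') by [].
  have {}col : r2 = r1 + (q' - p'.+1).+1 -> ~~ asc (w p') (w q') by [].
  move: row col; rewrite /asc; move: (w p') (w q') => u v row col.
  by split; apply/and4P; split; apply/implyP; lia.
case: (ltngtP p q) => [lt|lt|->].
- by have [] := key _ _ lt ltq.
- by have [] := key _ _ lt ltp.
by rewrite /valid_pair !ltnn !andbF.
Qed.

Local Open Scope ring_scope.

(** * Descent classes of words *)

Section TransferSums.
Variables (A : comNzRingType) (I : finType) (e : rel I) (y : I -> A).

Fixpoint follows (b : seq bool) (u : I) (w : seq I) : bool :=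
  match b, w with
  | [::], [::] => true
  | d :: b', v :: w' => (e u v (+) d) && follows b' v w'
  | _, _ => false
  end.

Fixpoint ext_sum (b : seq bool) (u : I) : A :=
  if b is d :: b' then \sum_(v | e u v (+) d) y v * ext_sum b' v else 1.

Definition ribbon_sum (b : seq bool) : A := \sum_u y u * ext_sum b u.

(** The middle step is either an ascent or not; summing over both choices removes the condition
    there and leaves two independent words. *)
Lemma ext_sum_cat b1 b2 u :
  ext_sum (b1 ++ true :: b2) u + ext_sum (b1 ++ false :: b2) u =
  ext_sum b1 u * ribbon_sum b2.
Proof.
elim: b1 u => [|d b1 IH] u /=.
  rewrite mul1r /ribbon_sum [RHS](bigID (e u)) /= addrC.
  by congr (_ + _); apply: eq_bigl => v; case: (e u v).
rewrite mulr_suml -big_split /=; apply: eq_bigr => v _; by rewrite -mulrDr IH mulrA.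
Qed.

Lemma ribbon_sum_cat b1 b2 :
  ribbon_sum (b1 ++ true :: b2) =
  ribbon_sum b1 * ribbon_sum b2 - ribbon_sum (b1 ++ false :: b2).
Proof.
apply/eqP; rewrite eq_sym subr_eq eq_sym; apply/eqP.
rewrite {1 2 3}/ribbon_sum mulr_suml -big_split /=; apply: eq_bigr => v _.
by rewrite -mulrDr ext_sum_cat mulrA.
Qed.

Lemma big_tupleS n (P : pred (seq I)) (F : seq I -> A) :
  \sum_(w : n.+1.-tuple I | P w) F w =
  \sum_u \sum_(w : n.-tuple I | P (u :: w)) F (u :: w).
Proof.
rewrite pair_big_dep /=.
rewrite (reindex (fun p : I * n.-tuple I => cons_tuple p.1 p.2)) /=; last first.
  exists (fun w : n.+1.-tuple I => (thead w, [tuple of behead w])) => [[u w] _|w _] /=.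
    by congr pair; apply: val_inj.
  by rewrite [RHS]tuple_eta; apply: val_inj.
by [].
Qed.

Lemma ext_sumE b u :
  ext_sum b u =
  \sum_(w : (size b).-tuple I | follows b u w) \prod_(v <- w) y v.
Proof.
elim: b u => [|d b IH] u /=.
  by rewrite (eq_bigl (pred1 [tuple])) ?big_pred1_eq ?big_nil // => w; rewrite [w]tuple0 /= eqxx.
rewrite (@big_tupleS _ (fun w => follows (d :: b) u w) (fun w => \prod_(v <- w) y v)) /=.
rewrite big_mkcond /=; apply: eq_bigr => v _.
case: (e u v (+) d) => /=; last by rewrite big_pred0_eq.
rewrite IH mulr_sumr; apply: eq_bigr => w _.
by rewrite big_cons.
Qed.

Definition matches (b : seq bool) (w : seq I) : bool :=
  if w is u :: w' then follows b u w' else false.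

(** The length N is a variable so that it can be instantiated by [sumn a] without a cast between
    tuple types. *)
Lemma ribbon_sumE N b : N = (size b).+1 ->
  ribbon_sum b = \sum_(w : N.-tuple I | matches b w) \prod_(v <- w) y v.
Proof.
move=> ->; rewrite (@big_tupleS _ (matches b) (fun w => \prod_(v <- w) y v)) /=.
apply: eq_bigr => u _; rewrite ext_sumE mulr_sumr; apply: eq_bigr => w _.
by rewrite big_cons.
Qed.

Lemma followsP b u (w : seq I) : size w = size b ->
  reflect (forall p, (p < size b)%N ->
             e (nth u (u :: w) p) (nth u w p) (+) nth false b p)
          (follows b u w).
Proof.
move=> sz; apply: (iffP idP).
  elim: b u w sz => [|d b IH] u [|v w] //= [sz] /andP[h1 h2] [|p] //= hp.
  have := IH v w sz h2 p hp.
  by rewrite !(set_nth_default u v) //= ?sz // ltnS ltnW // sz.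
elim: b u w sz => [|d b IH] u [|v w] //= [sz] h.
have /= -> := h 0%N (ltn0Sn _) => /=.
apply: IH => // p hp; have := h p.+1 hp.
by rewrite /= !(set_nth_default u v) //= ?sz // ltnS ltnW // sz.
Qed.

End TransferSums.

(** * The generating function of one-row ribbons *)

Section RowGeneratingFunction.
Variables (A : comNzRingType) (nv : nat) (x : nat -> A).

Definition letter_asc (u v : 'I_(2 * nv)) : bool := asc u v.
Definition letter_wt (u : 'I_(2 * nv)) : A := x u./2.

(** This is q_i on the letters of code at least j; moving j upwards computes the row generating
    function one letter at a time. *)
Definition row_sum_from (i j : nat) : A :=
  if i is i'.+1 then
    \sum_(v : 'I_(2 * nv) | (j <= v)%N)
       letter_wt v * ext_sum letter_asc letter_wt (nseq i' false) v
  else 1.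

Definition row_sum (i : nat) := row_sum_from i 0.

Lemma ribbon_sum_row i :
  ribbon_sum letter_asc letter_wt (nseq i false) = row_sum i.+1.
Proof. by []. Qed.

Lemma ascE u v : asc u v = (u + ~~ odd u <= v)%N.
Proof. by rewrite /asc; case: (odd u) => /=; lia. Qed.

Lemma ext_sum_row i u :
  ext_sum letter_asc letter_wt (nseq i false) u =
  row_sum_from i (u + ~~ odd u).
Proof.
case: i => [|i] //=; apply: eq_bigl => v.
by rewrite addbF /letter_asc ascE.
Qed.

Lemma row_sum_fromS i j : (j < 2 * nv)%N ->
  row_sum_from i.+1 j =
  row_sum_from i.+1 j.+1 + x j./2 * row_sum_from i (j + ~~ odd j).
Proof.
move=> hj; rewrite /= (bigD1 (Ordinal hj)) //= addrC; congr (_ + _).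
  by apply: eq_bigl => v; rewrite -val_eqE /=; lia.
by rewrite ext_sum_row.
Qed.

Lemma row_sum_from_max i : row_sum_from i (2 * nv) = (i == 0%N)%:R.
Proof.
case: i => [|i] //=; rewrite big_pred0 // => v.
by apply/negbTE; rewrite -ltnNge ltn_ord.
Qed.

Arguments row_sum_from : simpl never.
Variable N : nat.
Definition row_poly j : {poly A} := \poly_(i < N.+1) row_sum_from i j.

(** A marked letter occurs at most once in a row, whence the factor 1 + x X. The last term removes
    the coefficient of degree N + 1 that the product creates beyond the truncation. *)
Lemma row_poly_marked v : (v < nv)%N ->
  row_poly (2 * v) = (1 + (x v)%:P * 'X) * row_poly (2 * v).+1
     - (x v * row_sum_from N (2 * v).+1)%:P * 'X^(N.+1).
Proof.
move=> hv; apply/polyP => i.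
rewrite mulrDl mul1r -mulrA (mulrC 'X) coefB coefD !coefCM coefXn coefMX !coef_poly.
case: i => [|i] /=; first by rewrite !mulr0 addr0 subr0.
rewrite !ltnS eqSS.
have -> : row_sum_from i.+1 (2 * v) = row_sum_from i.+1 (2 * v).+1
     + x v * row_sum_from i (2 * v).+1.
  rewrite row_sum_fromS; last by lia.
  by rewrite mul2n odd_double doubleK addn1.
by case: (ltngtP i N) => [h|h|->]; rewrite ?leqnn ?mulr0 ?addr0 ?subr0 //= mulr1 add0r subrr.
Qed.

(** An unmarked letter may repeat, so it contributes a geometric series, and discarding it
    multiplies by 1 - x X. *)
Lemma row_poly_unmarked v : (v < nv)%N ->
  row_poly (2 * v.+1) = (1 - (x v)%:P * 'X) * row_poly (2 * v).+1
     + (x v * row_sum_from N (2 * v).+1)%:P * 'X^(N.+1).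
Proof.
move=> hv; apply/polyP => i.
rewrite mulrBl mul1r -mulrA (mulrC 'X) coefD coefB !coefCM coefXn coefMX !coef_poly.
case: i => [|i] /=; first by rewrite !mulr0 addr0 subr0.
rewrite !ltnS eqSS.
have -> : row_sum_from i.+1 (2 * v).+1 = row_sum_from i.+1 (2 * v.+1)
     + x v * row_sum_from i (2 * v).+1.
  rewrite row_sum_fromS; last by lia.
  by rewrite !mul2n /= odd_double uphalf_double addn0.
case: (ltngtP i N) => [h|h|->]; rewrite ?leqnn ?mulr0 ?addr0 ?subr0 ?addrK //= mulr1.
by rewrite sub0r addNr.
Qed.

Lemma row_poly_gf :
  exists H, (\prod_(v < nv) (1 - (x v)%:P * 'X)) * row_poly 0 =
            \prod_(v < nv) (1 + (x v)%:P * 'X) + 'X^(N.+1) * H.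
Proof.
suff step k : (k <= nv)%N ->
    exists H, (\prod_(v < k) (1 - (x v)%:P * 'X)) * row_poly 0 =
      \prod_(v < k) (1 + (x v)%:P * 'X) * row_poly (2 * k) + 'X^(N.+1) * H.
  have [H eH] := step nv (leqnn _); exists H; rewrite eH.
  suff -> : row_poly (2 * nv) = 1 by rewrite mulr1.
  by apply/polyP => i; rewrite coef_poly row_sum_from_max coef1; case: i => [|i] //=; case: ifP.
elim: k => [|k IH] hk.
  by exists 0; rewrite !big_ord0 !mul1r mulr0 addr0.
have [H eH] := IH (ltnW hk).
set c := (x k * row_sum_from N (2 * k).+1)%:P : {poly A}.
set P := \prod_(v < k) (1 + (x v)%:P * 'X) in eH *.
set a := (x k)%:P * 'X : {poly A}.
(* Eliminating [row_poly (2 * k).+1] between the two recursions leaves their truncation terms,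
   multiplied by 1 + a and 1 - a. *)
exists ((1 - a) * H - P * ((1 + a) * c + (1 - a) * c)).
rewrite !big_ord_recr /= -/P -/a.
transitivity ((1 - a) * (P * row_poly (2 * k) + 'X^(N.+1) * H)).
  by rewrite -eH; ring.
rewrite row_poly_marked // row_poly_unmarked // -/a -/c.
by ring.
Qed.

End RowGeneratingFunction.

(** * From coefficients to polynomials in the variables *)

Section Generating.
Variables (A : comNzRingType) (x : nat -> A) (nv : nat).

(** The bound n makes the exponent vectors a finite type; each w then contributes to exactly one of
    them. *)
Lemma content_gf (W : finType) (P : pred W) (c : W -> 'I_nv -> nat) n :
  (forall w v, c w v <= n)%N ->
  \sum_(mu : {ffun 'I_nv -> 'I_n.+1})
     #|[set w | P w && [forall v, c w v == mu v]]|%:R * \prod_(v < nv) x v ^+ mu v =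
  \sum_(w | P w) \prod_(v < nv) x v ^+ c w v.
Proof.
move=> cn.
under eq_bigr => mu _.
  rewrite -sum1_card natr_sum mulr_suml.
  under eq_bigl => w do rewrite inE.
  over.
rewrite (exchange_big_dep P) /=; last by move=> mu w _ /andP[].
apply: eq_bigr => w Pw.
pose mu0 : {ffun 'I_nv -> 'I_n.+1} := [ffun v => inord (c w v)].
have mu0E v : mu0 v = c w v :> nat by rewrite ffunE inordK // ltnS.
rewrite (big_pred1 mu0) => [|mu].
  by rewrite mul1r; apply: eq_bigr => v _; rewrite mu0E.
rewrite Pw /=; apply/forallP/eqP => [h|-> v]; last by rewrite mu0E.
by apply/ffunP => v; apply: val_inj; rewrite /= mu0E; apply/esym/eqP.
Qed.

Lemma pcoef_gf lam n : sumn lam = n ->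
  \sum_(mu : {ffun 'I_nv -> 'I_n.+1})
     (pcoef lam nv (fun v => mu v))%:R * \prod_(v < nv) x v ^+ mu v =
  \prod_(j <- lam) \sum_(v < nv) x v ^+ j.
Proof.
move=> <-; rewrite (@content_gf {ffun 'I_(size lam) -> 'I_nv} xpredT
   (fun f v => \sum_(j | f j == v) nth 0%N lam j)%N); last first.
  move=> f v; rewrite sumnE (big_nth 0%N) big_mkord [leqRHS](bigID (fun j => f j == v)) /=.
  exact: leq_addr.
rewrite (big_nth 0%N) big_mkord bigA_distr_bigA /=.
apply: eq_bigr => f _.
rewrite (partition_big f xpredT) //=; apply: eq_bigr => v _.
rewrite -prodrXr; apply: eq_bigr => j /eqP ->.
by [].
Qed.

Lemma half_subproof (u : 'I_(2 * nv)) : (u./2 < nv)%N.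
Proof. by rewrite ltn_half_double -mul2n. Qed.

Lemma cell_perm a : all (fun x => 0 < x)%N a ->
  exists p : {perm 'I_(sumn a)}, forall i : 'I_(sumn a), cell_of a i = path_cell a (p i).
Proof.
move=> ha; have hperm := perm_cells ha.
have sz : size (cells a) == sumn a by rewrite (perm_size hperm) size_map size_iota.
have sz' : size [seq path_cell a p | p <- iota 0 (sumn a)] == sumn a.
  by rewrite size_map size_iota.
have /tuple_permP [p hp] : perm_eq (Tuple sz) (Tuple sz') by [].
exists p => i; rewrite /cell_of.
have -> : cells a = Tuple sz by [].
rewrite hp.
rewrite -(@tnth_nth (sumn a) _ (0%N, 0%N) (mktuple (fun i => tnth (Tuple sz') (p i)))).
rewrite tnth_mktuple (tnth_nth (0%N, 0%N)) /= (nth_map 0%N) ?size_iota //.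
by rewrite nth_iota.
Qed.

Lemma matchesP b (w : seq 'I_(2 * nv)) : size w = (size b).+1 ->
  reflect (forall p, (p.+1 < size w)%N ->
      asc (nth 0%N (map val w) p) (nth 0%N (map val w) p.+1) (+) nth false b p)
    (matches (@letter_asc nv) b w).
Proof.
case: w => [|u w] //= [sz].
apply: (iffP (followsP _ u sz)) => h p; rewrite ?ltnS => hp.
  have := h p; rewrite -sz => /(_ hp); rewrite /letter_asc /=.
  rewrite -(nth_map _ 0%N val) //= -?(nth_map u 0%N val) //=.
  by rewrite ltnW.
have := h p; rewrite ltnS sz => /(_ hp); rewrite /letter_asc /=.
rewrite -[in X in _ -> X](nth_map _ 0%N val) //= -?(nth_map u 0%N val) //= ?sz //.
by rewrite ltnW.
Qed.

Lemma rcoef_gf a : is_composition a ->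
  \sum_(mu : {ffun 'I_nv -> 'I_(sumn a).+1})
     (rcoef a nv (fun v => mu v))%:R * \prod_(v < nv) x v ^+ mu v =
  ribbon_sum (@letter_asc nv) (@letter_wt A nv x) (behead (steps a)).
Proof.
move=> /andP[a0 ha].
have sN : sumn a = (size (behead (steps a))).+1.
  rewrite size_behead size_steps //.
  by case: a a0 ha => [|[|n] a] //= _ _; rewrite -?addnE ?addSn.
rewrite (ribbon_sumE _ _ sN).
rewrite (@content_gf {ffun 'I_(sumn a) -> 'I_(2 * nv)}
  (fun T => valid_filling a (fun i => if insub i is Some i' then val (T i') else 0%N))
   (fun T v => #|[set k | (val (T k))./2 == val v]|)); last first.
  by move=> T v; rewrite -[leqRHS]card_ord max_card.
have [p hp] := cell_perm ha.
(* Fillings are indexed in the order of [cells]; p turns them into words read along the walk. *)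
rewrite (reindex (fun w : (sumn a).-tuple 'I_(2 * nv) => [ffun i => tnth w (p i)])) /=;
  last first.
  exists (fun T : {ffun 'I_(sumn a) -> 'I_(2 * nv)} => [tuple T ((p^-1)%g i) | i < sumn a]).
    by move=> w _; apply: eq_from_tnth => i; rewrite tnth_mktuple ffunE permKV.
  by move=> T _; apply/ffunP => i; rewrite ffunE tnth_mktuple permK.
apply: eq_big => [w|w _]; last first.
  rewrite big_tuple (reindex_inj (@perm_inj _ p)) /=.
  rewrite (partition_big (fun k => Ordinal (half_subproof (tnth w (p k)))) xpredT) //=.
  apply: eq_bigr => v _.
  rewrite -prodr_const; apply: eq_big => [k|k].
    by rewrite inE ffunE -val_eqE.
  by rewrite /letter_wt inE ffunE => /eqP ->.
pose W q := nth 0%N (map val w) q.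
have WE (q : 'I_(sumn a)) : val (tnth w q) = W q.
  by rewrite (tnth_nth (tnth w q)) /W (nth_map (tnth w q)) ?size_tuple.
transitivity [forall i : 'I_(sumn a), forall j : 'I_(sumn a),
   valid_pair (path_cell a i) (path_cell a j) (i != j) (W i) (W j)].
  apply/forallP/forallP => h i; apply/forallP => j.
    have /forallP /(_ ((p^-1)%g j)) := h ((p^-1)%g i).
    rewrite !hp !permKV !valK !ffunE !permKV !WE.
    by rewrite (inj_eq (@perm_inj _ _)).
  have /forallP /(_ (p j)) := h (p i).
  by rewrite /= !hp !valK !ffunE !WE (inj_eq (@perm_inj _ _)).
have := path_pairP W ha.
have hb q : nth false (behead (steps a)) q = nth false (steps a) q.+1.
  by rewrite nth_behead.
move=> [h1 h2].
have sz : size w = (size (behead (steps a))).+1 by rewrite size_tuple.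
apply/idP/(matchesP sz) => h.
  rewrite size_tuple => q hq; rewrite hb; apply: h1 hq => i j hi hj.
  by have /forallP /(_ (Ordinal hj)) := forallP h (Ordinal hi).
apply/forallP => i; apply/forallP => j.
rewrite -(inj_eq val_inj); apply: h2 => // q hq; rewrite -hb.
by apply: h; rewrite size_tuple.
Qed.
End Generating.

(** * Coefficients on at most three power sums *)

Definition ind (b : bool) : int := (b : nat)%:Z.

(** The artificial first [true] is put back in front of b, so that y counts the boxes preceding the
    step; beyond the last box the default is no cut. *)
Definition cut (b : seq bool) (y : nat) : int := ind (nth false (true :: b) y).

(* [coef2] and [coef3] are, up to sign and a positive factor, the coefficients of
   p_p p_q and p_p p_q p_r in the ribbon function: signed counts of the ordered
   set partitions of the parts whose block sums add up to positions of [true].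
   With F, G the numbers of parts x such that x, resp. n - x, is such a position
   and H the number of parts for which both are, coef3 = (1 - F)(1 - G) - H. *)
Definition coef2 (b : seq bool) (p q : nat) : int := 1 - cut b p - cut b q.

Definition coef3 (b : seq bool) (p q r : nat) : int :=
  1 - cut b p - cut b q - cut b r
    - cut b (p + q) - cut b (p + r) - cut b (q + r)
    + cut b p * (cut b (p + q) + cut b (p + r))
    + cut b q * (cut b (p + q) + cut b (q + r))
    + cut b r * (cut b (p + r) + cut b (q + r)).

(** * Splitting off the first row of the walk *)

Section Cuts.
Variables (m : nat) (b2 : seq bool).
Hypothesis m_gt0 : (0 < m)%N.
Let b := nseq m.-1 false ++ true :: b2.
Let b' := nseq m.-1 false ++ false :: b2.

(** The correction at p = 0 is the artificial first [true] of b2: in b' the first row is merged with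
    what follows, so there is no cut at m. *)
Lemma cut_add p : cut b' (m + p) = cut b2 p - ind (p == 0%N).
Proof.
rewrite /cut /b'; case: m m_gt0 => // n _; rewrite addSn /= nth_cat size_nseq.
rewrite ltnNge leq_addr /= addKn; case: p => [|p] /=; by rewrite ?subrr ?subr0.
Qed.

Lemma cut_small p : (0 < p <= m)%N -> cut b' p = 0.
Proof.
rewrite /cut /b'; case: p m m_gt0 => [|p] [|n] //= _; rewrite ltnS leq_eqVlt.
rewrite nth_cat size_nseq nth_nseq => /orP[/eqP ->|->]; last by [].
by rewrite ltnn subnn.
Qed.

Lemma cut_true p : cut b p = ind (m == p) + cut b' p.
Proof.
rewrite /cut /b /b'; case: m m_gt0 p => // n _ [|p] //=.
rewrite eqSS !nth_cat size_nseq nth_nseq; case: (ltngtP p n) => h.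
- by rewrite add0r.
- by case E: (p - n)%N => [|d] /=; [lia|rewrite add0r].
by rewrite h subnn.
Qed.

Lemma ind_cut p q : (0 < q)%N -> ind (m == p) * cut b' (p + q) = ind (m == p) * cut b2 q.
Proof.
move=> q0; case: eqP => [<-|_]; last by rewrite /ind !mul0r.
by rewrite cut_add; case: q q0 => // q _; rewrite subr0.
Qed.

Lemma cut_ind p q : (0 < p)%N -> cut b' p * ind (m == (p + q)%N) = 0.
Proof.
move=> p0; case: eqP => [E|_]; last by rewrite /ind mulr0.
by rewrite cut_small ?mul0r // p0 E leq_addr.
Qed.

Lemma ind_ind p q : (0 < q)%N -> ind (m == p) * ind (m == (p + q)%N) = 0.
Proof. by rewrite /ind; lia. Qed.

Lemma coef2_cut p q N : (0 < p)%N -> (0 < q)%N ->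
  ind (m == p) * ind (N == q) + ind (m == q) * ind (N == p) =
  ind ((m + N)%N == (p + q)%N) * (coef2 b' p q - coef2 b p q).
Proof.
move=> p0 q0; rewrite /coef2 !cut_true.
rewrite (_ : _ - _ = ind (m == p) + ind (m == q)); last by ring.
by rewrite /ind; lia.
Qed.

(** Coefficient form of r_b = q_m r_b2 - r_b', N standing for the number of boxes of b2. On the
    left, the row of length m takes one part and the rest two, or the row two parts and the rest
    one. *)
Lemma coef3_cut p q r N : (0 < p)%N -> (0 < q)%N -> (0 < r)%N ->
  ind (m == p) * (ind (N == (q + r)%N) * coef2 b2 q r)
  + ind (m == q) * (ind (N == (p + r)%N) * coef2 b2 p r)
  + ind (m == r) * (ind (N == (p + q)%N) * coef2 b2 p q)
  + ind (m == (p + q)%N) * ind (N == r)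
  + ind (m == (p + r)%N) * ind (N == q)
  + ind (m == (q + r)%N) * ind (N == p) =
  ind ((m + N)%N == (p + q + r)%N) * (coef3 b' p q r - coef3 b p q r).
Proof.
move=> p0 q0 r0.
(* The sequences b and b' differ by the cut at m alone; b' has no cut up to m, and beyond m it has
   those of b2. *)
have -> : coef3 b' p q r - coef3 b p q r =
   ind (m == p) * coef2 b2 q r + ind (m == q) * coef2 b2 p r
   + ind (m == r) * coef2 b2 p q + ind (m == (p + q)%N)
  + ind (m == (p + r)%N) + ind (m == (q + r)%N).
  rewrite /coef3 !cut_true /coef2.
  have := (ind_cut p q0, ind_cut p r0, ind_cut q p0, ind_cut q r0, ind_cut r p0, ind_cut r q0).
  have := (cut_ind q p0, cut_ind r p0, cut_ind p q0, cut_ind r q0, cut_ind p r0, cut_ind q r0).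
  have := (ind_ind p q0, ind_ind p r0, ind_ind q p0, ind_ind q r0, ind_ind r p0, ind_ind r q0).
  rewrite (addnC q p) (addnC r p) (addnC r q).
  move=> [[[[[h1 h2] h3] h4] h5] h6] [[[[[g1 g2] g3] g4] g5] g6] [[[[[k1 k2] k3] k4] k5] k6].
  by lra.
have E1 a c d : (m + N = a + c + d)%N -> (N == (c + d)%N) = (m == a) by lia.
case: (eqVneq (m + N)%N (p + q + r)%N) => [E|E]; last first.
  have Z a c (X : int) : (a + c = p + q + r)%N -> ind (m == a) * (ind (N == c) * X) = 0.
    by move=> h; rewrite mulrA (_ : _ * ind _ = 0) ?mul0r // /ind; lia.
  have Z' a c : (a + c = p + q + r)%N -> ind (m == a) * ind (N == c) = 0.
    by move=> h; rewrite /ind; lia.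
  by rewrite !Z ?Z' ?mul0r ?addr0 //; lia.
have Z a c (X : int) : (a + c = p + q + r)%N -> ind (m == a) * (ind (N == c) * X) = ind (m == a) * X.
  by move=> h; rewrite mulrA (_ : _ * ind _ = ind (m == a)) // /ind; lia.
have Z' a c : (a + c = p + q + r)%N -> ind (m == a) * ind (N == c) = ind (m == a).
  by move=> h; rewrite /ind; lia.
by rewrite !Z ?Z' ?mul1r //; lia.
Qed.

End Cuts.

(** * Ribbon functions modulo the squares of three parameters *)

Section Truncation.
Variables (A : comNzRingType) (s t u : A).

(** Congruence modulo the ideal generated by the squares of s, t and u. *)
Definition eqJ (F G : A) : Prop :=
  exists P Q W : A, F = G + s ^+ 2 * P + t ^+ 2 * Q + u ^+ 2 * W.

Lemma eqJ_mul F F' G G' : eqJ F F' -> eqJ G G' -> eqJ (F * G) (F' * G').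
Proof.
move=> [P [Q [W ->]]] [P' [Q' [W' ->]]].
set G0 := G' + _ + _ + _.
exists (P * G0 + F' * P'), (Q * G0 + F' * Q'), (W * G0 + F' * W').
by rewrite /G0; ring.
Qed.

Lemma eqJ_sub F F' G G' : eqJ F F' -> eqJ G G' -> eqJ (F - G) (F' - G').
Proof.
move=> [P [Q [W ->]]] [P' [Q' [W' ->]]].
by exists (P - P'), (Q - Q'), (W - W'); ring.
Qed.

Lemma eqJ_trans F G H : eqJ F G -> eqJ G H -> eqJ F H.
Proof.
move=> [P [Q [W ->]]] [P' [Q' [W' ->]]].
by exists (P + P'), (Q + Q'), (W + W'); ring.
Qed.

Definition squarefree (c1 c2 c3 c12 c13 c23 c123 : int) : A :=
  c1%:~R * s + c2%:~R * t + c3%:~R * u + c12%:~R * (s * t) + c13%:~R * (s * u)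
  + c23%:~R * (t * u) + c123%:~R * (s * t * u).

Lemma squarefree_mul c1 c2 c3 c12 c13 c23 c123 d1 d2 d3 d12 d13 d23 d123 :
  eqJ (squarefree c1 c2 c3 c12 c13 c23 c123 * squarefree d1 d2 d3 d12 d13 d23 d123)
      (squarefree 0 0 0 (c1 * d2 + c2 * d1) (c1 * d3 + c3 * d1) (c2 * d3 + c3 * d2)
         (c1 * d23 + c2 * d13 + c3 * d12 + c12 * d3 + c13 * d2 + c23 * d1)).
Proof.
rewrite /squarefree !intrD !intrM.
move: c1%:~R c2%:~R c3%:~R c12%:~R c13%:~R c23%:~R c123%:~R => {}c1 {}c2 {}c3 {}c12 {}c13 {}c23 {}c123.
move: d1%:~R d2%:~R d3%:~R d12%:~R d13%:~R d23%:~R d123%:~R => {}d1 {}d2 {}d3 {}d12 {}d13 {}d23 {}d123.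
pose cs := c1 + c12 * t + c13 * u + c123 * t * u.
pose ds := d1 + d12 * t + d13 * u + d123 * t * u.
(* The first factor is s cs + t (c2 + c23 u) + u c3, and likewise the second. The product of the two
   s-terms gives the first quotient; the remaining multiples of t^2, then of u^2, give the
   others. *)
exists (cs * ds).
exists ((c2 + c23 * u) * (d2 + d23 * u)
  + s * ((c2 + c23 * u) * (d12 + d123 * u) + (d2 + d23 * u) * (c12 + c123 * u))).
exists (c3 * d3 + t * (c3 * d23 + d3 * c23)
 + s * (c3 * d13 + d3 * c13 + t * (c3 * d123 + d3 * c123 + c23 * d13 + d23 * c13))).
by rewrite /cs /ds; ring.
Qed.

Variables (i j k nv : nat) (x : nat -> A).
Hypotheses (i_gt0 : (0 < i)%N) (j_gt0 : (0 < j)%N) (k_gt0 : (0 < k)%N).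
Let E (e : A) : {poly A} :=
  (1 + (e * s)%:P * 'X^i) * (1 + (e * t)%:P * 'X^j) * (1 + (e * u)%:P * 'X^k).
Hypothesis alphabet_p : \prod_(v < nv) (1 + (x v)%:P * 'X) = E 1.
Hypothesis alphabet_m : \prod_(v < nv) (1 - (x v)%:P * 'X) = E (-1).

(** The row generating function is the product of (1 + y) / (1 - y) over y = s X^i, t X^j, u X^k,
    and each quotient is 1 + 2y modulo y^2. This produces the factors 2, 4 and 8. *)
Lemma row_sum_eqJ m : (0 < m)%N ->
  eqJ (row_sum nv x m)
   (squarefree (2 * ind (m == i)) (2 * ind (m == j)) (2 * ind (m == k))
     (4 * ind (m == (i + j)%N)) (4 * ind (m == (i + k)%N)) (4 * ind (m == (j + k)%N))
     (8 * ind (m == (i + j + k)%N))).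
Proof.
move=> m0; have [H] := row_poly_gf nv x m.
rewrite alphabet_p alphabet_m /E !mul1r !mulN1r !rmorphN /= !mulNr.
set P := row_poly _ _ _ _.
pose si := s%:P * 'X^i; pose tj := t%:P * 'X^j; pose uk := u%:P * 'X^k : {poly A}.
rewrite -/si -/tj -/uk => gf.
(* Division by 1 - y is replaced by multiplication by 1 + y: this turns the coefficient of P into a
   product of factors 1 - y^2, and every y^2 goes into an explicit remainder. *)
have {gf}PE : P = (1 + 2 * si) * (1 + 2 * tj) * (1 + 2 * uk)
   + si ^+ 2 * (P * (1 - tj ^+ 2) * (1 - uk ^+ 2) + (1 + tj) ^+ 2 * (1 + uk) ^+ 2)
   + tj ^+ 2 * (P * (1 - uk ^+ 2) + (1 + 2 * si) * (1 + uk) ^+ 2)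
   + uk ^+ 2 * (P + (1 + 2 * si) * (1 + 2 * tj))
   + 'X^(m.+1) * (H * ((1 + si) * (1 + tj) * (1 + uk))).
  have : ((1 - si) * (1 - tj) * (1 - uk) * P) * ((1 + si) * (1 + tj) * (1 + uk)) =
     ((1 + si) * (1 + tj) * (1 + uk) + 'X^(m.+1) * H) * ((1 + si) * (1 + tj) * (1 + uk)).
    by rewrite gf.
  move=> /eqP; rewrite -subr_eq0 => /eqP gf'.
  apply/eqP; rewrite -subr_eq0; apply/eqP; rewrite -[RHS]gf'.
  by ring.
have -> : row_sum nv x m = P`_m by rewrite coef_poly ltnSn.
move: PE; set Y1 := _ + (1 + tj) ^+ 2 * _; set Y2 := _ + _ * (1 + uk) ^+ 2.
set Y3 := P + _; set Y4 := H * _ => ->.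
have sq (c : A) n (Y : {poly A}) : ((c%:P * 'X^n) ^+ 2 * Y)`_m = c ^+ 2 * ('X^n ^+ 2 * Y)`_m.
  by rewrite exprMn -rmorphXn -mulrA coefCM.
exists ('X^i ^+ 2 * Y1)`_m, ('X^j ^+ 2 * Y2)`_m, ('X^k ^+ 2 * Y3)`_m.
rewrite !coefD !sq coefXnM ltnSn addr0; congr (_ + _ + _ + _).
have -> : (1 + 2 * si) * (1 + 2 * tj) * (1 + 2 * uk) =
   1 + (2 * s)%:P * 'X^i + (2 * t)%:P * 'X^j + (2 * u)%:P * 'X^k
   + (4 * (s * t))%:P * 'X^(i + j) + (4 * (s * u))%:P * 'X^(i + k)
   + (4 * (t * u))%:P * 'X^(j + k) + (8 * (s * t * u))%:P * 'X^(i + j + k).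
  by rewrite /si /tj /uk !exprD !rmorphM /= !rmorph_nat; ring.
rewrite !coefD !coefCM !coefXn coef1 gtn_eqF // add0r /squarefree.
have indR b : (ind b)%:~R = b%:R :> A by [].
rewrite !intrM !indR.
by ring.
Qed.

Definition ribbon_coefs (b : seq bool) : A :=
  let c : int := (-1) ^+ count id b in let N := (size b).+1 in
  squarefree (c * (2 * ind (N == i))) (c * (2 * ind (N == j))) (c * (2 * ind (N == k)))
    (c * (4 * ind (N == (i + j)%N) * coef2 b i j))
    (c * (4 * ind (N == (i + k)%N) * coef2 b i k))
    (c * (4 * ind (N == (j + k)%N) * coef2 b j k))
    (c * (8 * ind (N == (i + j + k)%N) * coef3 b i j k)).

Lemma cut_nseq n y : (0 < y)%N -> cut (nseq n false) y = 0.
Proof. by case: y => // y _; rewrite /cut /= nth_nseq if_same. Qed.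

(** Induction on length plus number of up steps. At the first up step [ribbon_sum_cat] leaves a row,
    a shorter ribbon b2 and a ribbon b' with one up step less; without up steps the ribbon is a
    row. *)
Lemma ribbon_sum_eqJ b :
  eqJ (ribbon_sum (@letter_asc nv) (@letter_wt A nv x) b) (ribbon_coefs b).
Proof.
have [n] := ubnP (size b + count id b)%N.
elim: n b => // n IH b /ltnSE le_n.
have [hb|hb] := boolP (has id b); last first.
  have bE : b = nseq (size b) false.
    apply: (@eq_from_nth _ false) => [|p hp]; first by rewrite size_nseq.
    rewrite nth_nseq hp; apply/negbTE; move/hasPn: hb; apply.
    by apply: mem_nth.
  rewrite {1}bE ribbon_sum_row; have := @row_sum_eqJ (size b).+1 isT.
  have c0 : count id b = 0%N by apply/eqP; rewrite -leqn0 leqNgt -has_count.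
  rewrite /ribbon_coefs c0 expr0 !mul1r.
  rewrite bE size_nseq /coef2 /coef3 !cut_nseq ?addn_gt0 ?i_gt0 ?j_gt0 ?k_gt0 //.
  have -> : (1 - 0 - 0 - 0 - 0 - 0 - 0 + 0 * (0 + 0) + 0 * (0 + 0) + 0 * (0 + 0) : int) = 1 by [].
  by rewrite !mulr1.
have [m [b2 bE]] : exists m b2, b = nseq m false ++ true :: b2.
  elim: b hb {IH le_n} => [|[] b IHb] //= h; first by exists 0%N, b.
  by have [m [b2 ->]] := IHb h; exists m.+1, b2.
rewrite bE ribbon_sum_cat ribbon_sum_row.
set b' := nseq m false ++ false :: b2.
have [IH1 IH2] : eqJ (ribbon_sum (@letter_asc nv) (@letter_wt A nv x) b2) (ribbon_coefs b2) /\
   eqJ (ribbon_sum (@letter_asc nv) (@letter_wt A nv x) b') (ribbon_coefs b').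
  split; apply: IH; move: le_n; rewrite bE /b' !size_cat !count_cat /= !size_nseq; lia.
have := eqJ_sub (eqJ_mul (@row_sum_eqJ m.+1 isT) IH1) IH2.
move=> /eqJ_trans; apply.
apply: eqJ_trans (eqJ_sub (squarefree_mul _ _ _ _ _ _ _ _ _ _ _ _ _ _) _) _.
  by exists 0, 0, 0; rewrite !mulr0 !addr0.
exists 0, 0, 0; rewrite !mulr0 !addr0.
have cE : count id (nseq m false ++ true :: b2) = (count id b2).+1.
  by rewrite count_cat count_nseq /= add0n.
have c'E : count id b' = count id b2 by rewrite /b' count_cat count_nseq /= add0n.
have sE : size (nseq m false ++ true :: b2) = (m + (size b2).+1)%N.
  by rewrite size_cat size_nseq.
have s'E : size b' = (m + (size b2).+1)%N by rewrite size_cat size_nseq.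
rewrite /ribbon_coefs cE c'E sE s'E exprS mulN1r -addSn.
have e12 p q := @coef2_cut m.+1 b2 isT p q (size b2).+1.
have e123 := @coef3_cut m.+1 b2 isT i j k (size b2).+1 i_gt0 j_gt0 k_gt0.
move: (e12 i j i_gt0 j_gt0) (e12 i k i_gt0 k_gt0) (e12 j k j_gt0 k_gt0) e123.
rewrite {e12} /= -/b'; set N := (size b2).+1; set c : int := (-1) ^+ _.
set bb := nseq m false ++ true :: b2.
move=> e12 e13 e23 e123.
have -> : c * (8 * ind ((m.+1 + N)%N == (i + j + k)%N) * coef3 b' i j k) =
   c * 8 * (ind ((m.+1 + N)%N == (i + j + k)%N) * (coef3 b' i j k - coef3 bb i j k))
   + c * (8 * ind ((m.+1 + N)%N == (i + j + k)%N) * coef3 bb i j k) by ring.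
have step p q : c * (4 * ind ((m.+1 + N)%N == (p + q)%N) * coef2 b' p q) =
   c * 4 * (ind ((m.+1 + N)%N == (p + q)%N) * (coef2 b' p q - coef2 bb p q))
   + c * (4 * ind ((m.+1 + N)%N == (p + q)%N) * coef2 bb p q) by ring.
rewrite !step -e12 -e13 -e23 -e123 /squarefree !(intrD, intrM, intrN).
by ring.
Qed.

End Truncation.

(** * Evaluation at roots of unity *)

(** Write 1 - z^v Z = -z^v (Z - z^(-v)): the second factors multiply to Z^n - 1, and the first to
    -1, by setting X = 0 in the factorization of X^n - 1. *)
Lemma prod_unity_roots (K : fieldType) (B : comNzRingType) (f : {rmorphism K -> B})
    n (z : K) (Z : B) : n.-primitive_root z ->
  \prod_(v < n) (1 - f (z ^+ v) * Z) = 1 - Z ^+ n.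
Proof.
move=> prz; have n0 := prim_order_gt0 prz.
have z0 : z != 0 by rewrite (prim_root_eq0 prz) -lt0n.
have prz' : n.-primitive_root z^-1.
  have -> : z^-1 = z ^+ n.-1.
    by apply: (mulfI z0); rewrite mulfV // -exprS prednK // (prim_expr_order prz).
  by rewrite (prim_root_exp_coprime _ prz); case: (n) n0 => // ? _; apply: coprimenS.
have PZ : \prod_(v < n) (Z - f (z^-1 ^+ v)) = Z ^+ n - 1.
  have := congr1 (fun p => (map_poly f p).[Z]) (factor_Xn_sub_1 prz').
  rewrite rmorph_prod horner_prod rmorphB /= map_polyXn rmorph1 !hornerE ?hornerXn.
  rewrite big_mkord => <-; apply: eq_bigr => v _.
  by rewrite rmorphB /= map_polyX map_polyC /= !hornerE.
have P0 : \prod_(v < n) (- z ^+ v) = -1.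
  have := congr1 (fun p => p.[0]) (factor_Xn_sub_1 prz).
  rewrite horner_prod !hornerE ?hornerXn expr0n gtn_eqF // sub0r big_mkord => <-.
  by apply: eq_bigr => v _; rewrite !hornerE ?add0r ?sub0r.
transitivity (f (\prod_(v < n) (- z ^+ v)) * \prod_(v < n) (Z - f (z^-1 ^+ v))).
  rewrite rmorph_prod -big_split /=; apply: eq_bigr => v _.
  rewrite mulrBr -rmorphM mulNr -exprMn mulfV // expr1n !rmorphN rmorph1 opprK.
  by rewrite addrC mulNr.
by rewrite P0 PZ rmorphN rmorph1 mulN1r opprB.
Qed.

Lemma sum_unity_roots_ge0 n (z : algC) m : n.-primitive_root z ->
  0 <= \sum_(v < n) (z ^+ v) ^+ m.
Proof.
move=> prz.
have -> : \sum_(v < n) (z ^+ v) ^+ m = \sum_(v < n) (z ^+ m) ^+ v.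
  by apply: eq_bigr => v _; rewrite exprAC.
have [->|zm1] := eqVneq (z ^+ m) 1.
  by apply: sumr_ge0 => v _; rewrite expr1n ler01.
suff -> : \sum_(v < n) (z ^+ m) ^+ v = 0 by [].
have := subrX1 (z ^+ m) n.
have -> : (z ^+ m) ^+ n = 1 by rewrite exprAC (prim_expr_order prz) expr1n.
rewrite subrr => /esym/eqP.
by rewrite mulf_eq0 subr_eq0 (negPf zm1) /= => /eqP.
Qed.

(** Nonnegativity of all coefficients, level by level, is packaged as a closed semiring so that it
    passes to sums and products. *)
Definition nneg_C : semiringClosed algC :=
  GRing.SemiringClosed.clone _ (@Num.Def.nneg_num_pred algC) _.
Definition nneg_poly : semiringClosed {poly algC} :=
  GRing.SemiringClosed.clone _ (polyOver_pred nneg_C) _.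
Definition nneg_poly2 : semiringClosed {poly {poly algC}} :=
  GRing.SemiringClosed.clone _ (polyOver_pred nneg_poly) _.
Definition nneg_poly3 : semiringClosed {poly {poly {poly algC}}} :=
  GRing.SemiringClosed.clone _ (polyOver_pred nneg_poly2) _.

Section RootsOfUnityAlphabet.
Variables i j k : nat.
Hypotheses (odd_i : odd i) (odd_j : odd j) (odd_k : odd k).

Let A := {poly {poly {poly algC}}}.
Let scal : {rmorphism algC -> A} := polyC \o (polyC \o polyC).
Let s0 : A := 'X.
Let t0 : A := 'X%:P.
Let u0 : A := 'X%:P%:P.

Variables zi zj zk : algC.
Hypotheses (prim_i : i.-primitive_root zi) (prim_j : j.-primitive_root zj)
  (prim_k : k.-primitive_root zk).

(* The alphabet s mu_i, t mu_j, u mu_k. *)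
Definition letter (v : nat) : A :=
  if (v < i)%N then scal (zi ^+ v) * s0
  else if (v < i + j)%N then scal (zj ^+ (v - i)) * t0
  else scal (zk ^+ (v - (i + j))) * u0.

Lemma big_letter (R : Type) (idx : R) (op : Monoid.law idx) (F : A -> R) :
  \big[op/idx]_(v < i + j + k) F (letter v) =
  op (op (\big[op/idx]_(v < i) F (scal (zi ^+ v) * s0))
         (\big[op/idx]_(v < j) F (scal (zj ^+ v) * t0)))
     (\big[op/idx]_(v < k) F (scal (zk ^+ v) * u0)).
Proof.
rewrite !big_split_ord /=; congr (op (op _ _) _); apply: eq_bigr => v _; rewrite /letter /=.
- by rewrite ltn_ord.
- by rewrite ltnNge leq_addr /= ltn_add2l ltn_ord addKn.
by rewrite !ltnNge leq_addr /= -addnA leq_addr /= addnA addKn.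
Qed.

(** Oddness of the orders enters here: for odd n both (-1)^n = -1 and e^n = e, so the signs e = 1
    and e = -1 give the two alphabet hypotheses of the truncation. *)
Lemma letter_prod (e : A) : e ^+ 2 = 1 ->
  \prod_(v < i + j + k) (1 + (e * letter v)%:P * 'X) =
  (1 + (e * s0 ^+ i)%:P * 'X^i) * (1 + (e * t0 ^+ j)%:P * 'X^j) * (1 + (e * u0 ^+ k)%:P * 'X^k).
Proof.
move=> e2.
rewrite (big_letter _ (fun y : A => 1 + (e * y)%:P * 'X)).
have step n (z : algC) (y : A) : odd n -> n.-primitive_root z ->
   \prod_(v < n) (1 + (e * (scal (z ^+ v) * y))%:P * 'X) = 1 + (e * y ^+ n)%:P * 'X^n.
  move=> odd_n prz.
  have := prod_unity_roots (polyC \o scal : {rmorphism algC -> {poly A}}) (- ((e * y)%:P * 'X)) prz.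
  have en : e ^+ n = e.
    by rewrite -(odd_double_half n) odd_n exprD -mul2n exprM e2 expr1n mulr1.
  rewrite exprNn -signr_odd odd_n mulN1r opprK exprMn -polyC_exp exprMn en => <-.
  apply: eq_bigr => v _; rewrite mulrN opprK [in RHS]mulrA; congr (1 + _ * _).
  transitivity ((scal (z ^+ v))%:P * (e * y)%:P); last by [].
  by rewrite -polyCM mulrCA.
by rewrite !step.
Qed.

(** The coefficient of s^i t^j u^k, s being the outermost variable and u the innermost. *)
Definition extract (F : A) : algC := F`_i`_j`_k.

Lemma extractD F G : extract (F + G) = extract F + extract G.
Proof. by rewrite /extract !coefD. Qed.

Lemma extract_scal c F : extract (scal c * F) = c * extract F.
Proof. by rewrite /extract /= !coefCM. Qed.

Lemma extract_int (c : int) F : extract (c%:~R * F) = c%:~R * extract F.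
Proof. by rewrite -(rmorph_int scal) extract_scal. Qed.

(** None of the generators s^(2i), t^(2j), u^(2k) divides s^i t^j u^k. *)
Lemma extract_eqJ F G : eqJ (s0 ^+ i) (t0 ^+ j) (u0 ^+ k) F G -> extract F = extract G.
Proof.
have [[i0 j0] k0] := (prim_order_gt0 prim_i, prim_order_gt0 prim_j, prim_order_gt0 prim_k).
have lt2 n : (0 < n)%N -> (n < n * 2)%N by apply: ltn_Pmulr.
move=> [P [Q [W ->]]]; rewrite /extract !coefD.
rewrite -!exprM /s0 /t0 /u0 coefXnM lt2 // !coef0 -!polyC_exp !coefCM coefXnM lt2 // coef0.
by rewrite coefXnM lt2 // ?coef0 ?mulr0 !addr0.
Qed.

Lemma extract_squarefree c1 c2 c3 c12 c13 c23 c123 :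
  extract (squarefree (s0 ^+ i) (t0 ^+ j) (u0 ^+ k) c1 c2 c3 c12 c13 c23 c123) = c123%:~R.
Proof.
have [[i0 j0] k0] := (prim_order_gt0 prim_i, prim_order_gt0 prim_j, prim_order_gt0 prim_k).
have mon a b c : extract (s0 ^+ a * t0 ^+ b * u0 ^+ c) = ((i == a) && (j == b) && (k == c))%:R.
  rewrite /extract /s0 /t0 /u0 -!polyC_exp !coefMC coefXn.
  case: eqP => _ /=; last by rewrite !(mul0r, coef0).
  rewrite !mul1r coefXn; case: eqP => _ /=; last by rewrite !(mul0r, coef0).
  by rewrite mul1r coefXn.
rewrite /squarefree !extractD !extract_int.
have := (mon i 0 0, mon 0 j 0, mon 0 0 k, mon i j 0, mon i 0 k, mon 0 j k, mon i j k)%N.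
rewrite !expr0 !mulr1 !mul1r !eqxx !(gtn_eqF i0) !(gtn_eqF j0) !(gtn_eqF k0) /=.
move=> [[[[[[-> ->] ->] ->] ->] ->] ->].
by rewrite !mulr0 !add0r mulr1.
Qed.

(** On this alphabet p_m is s^m p_m(mu_i) + t^m p_m(mu_j) + u^m p_m(mu_k), and the power sums of
    roots of unity are nonnegative. *)
Lemma extract_psum_ge0 (lam : seq nat) :
  0 <= extract (\prod_(m <- lam) \sum_(v < i + j + k) letter v ^+ m).
Proof.
have s0S : s0 \in nneg_poly3 by apply: (polyOverX nneg_poly2).
have t0S : t0 \in nneg_poly3.
  by rewrite [_ \in _](polyOverC nneg_poly2) [_ \in _](polyOverX nneg_poly).
have u0S : u0 \in nneg_poly3.
  rewrite [_ \in _](polyOverC nneg_poly2) [_ \in _](polyOverC nneg_poly).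
  exact: (polyOverX nneg_C).
have scalS c : 0 <= c -> scal c \in nneg_poly3.
  move=> c0; rewrite [_ \in _](polyOverC nneg_poly2) [_ \in _](polyOverC nneg_poly).
  by rewrite [_ \in _](polyOverC nneg_C).
suff /(polyOverP (S := nneg_poly2)) /(_ i) /(polyOverP (S := nneg_poly)) /(_ j)
    /(polyOverP (S := nneg_C)) /(_ k) :
  \prod_(m <- lam) \sum_(v < i + j + k) letter v ^+ m \in nneg_poly3 by [].
apply: rpred_prod => m _.
rewrite (big_letter _ (fun y => y ^+ m)).
have step n z (y : A) : n.-primitive_root z -> y \in nneg_poly3 ->
    \sum_(v < n) (scal (z ^+ v) * y) ^+ m \in nneg_poly3.
  move=> prz yS; under eq_bigr => v _ do rewrite exprMn -rmorphXn.
  rewrite -mulr_suml -rmorph_sum rpredM ?rpredX //.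
  by apply: scalS; apply: sum_unity_roots_ge0.
by rewrite !rpredD ?step.
Qed.

End RootsOfUnityAlphabet.

Theorem p_positive_coef3 a i j k : is_composition a -> r_p_positive a ->
  odd i -> odd j -> odd k -> (i + j + k)%N = sumn a ->
  0 <= (-1) ^+ (size a).-1 * coef3 (behead (steps a)) i j k.
Proof.
move=> comp_a [L [L1 L2]] odd_i odd_j odd_k sum_ijk.
have [[i0 j0] k0] := (odd_gt0 odd_i, odd_gt0 odd_j, odd_gt0 odd_k).
have [zi prim_i] := C_prim_root_exists i0.
have [zj prim_j] := C_prim_root_exists j0.
have [zk prim_k] := C_prim_root_exists k0.
pose x := letter i j zi zj zk; pose nv := (i + j + k)%N.
pose scal : {rmorphism algC -> {poly {poly {poly algC}}}} := polyC \o (polyC \o polyC).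
pose b := behead (steps a).
have RL : ribbon_sum (@letter_asc nv) (@letter_wt _ nv x) b =
    \sum_(y <- L) scal (ratr y.2) * \prod_(m <- y.1) \sum_(v < nv) x v ^+ m.
  rewrite -rcoef_gf //.
  transitivity (\sum_(mu : {ffun 'I_nv -> 'I_(sumn a).+1}) \sum_(y <- L)
     scal (ratr y.2) * ((pcoef y.1 nv (fun v => mu v))%:R * \prod_(v < nv) x v ^+ mu v)).
    apply: eq_bigr => mu _.
    have natE n : scal (ratr n%:R) = n%:R by rewrite ratr_nat rmorph_nat.
    have morD c d : scal (ratr (c + d)) = scal (ratr c) + scal (ratr d) by rewrite !rmorphD.
    have mor0 : scal (ratr 0) = 0 by rewrite -[0]/(0%:R) natE.
    have morM c d : scal (ratr (c * d)) = scal (ratr c) * scal (ratr d).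
      by rewrite [ratr (c * d)]rmorphM [LHS](rmorphM scal).
    rewrite -natE L2 (big_morph (fun c => scal (ratr c)) morD mor0).
    by rewrite mulr_suml; apply: eq_bigr => y _; rewrite morM natE mulrA.
  rewrite exchange_big /= big_seq [RHS]big_seq; apply: eq_bigr => y yL.
  rewrite -mulr_sumr; congr (_ * _).
  have [/and3P[_ _ /eqP sy] _] := L1 _ yL.
  exact: pcoef_gf.
have ge0 : 0 <= extract i j k (ribbon_sum (@letter_asc nv) (@letter_wt _ nv x) b).
  rewrite RL.
  rewrite (big_morph _ (@extractD i j k) (_ : extract i j k 0 = 0)); last first.
    by rewrite /extract !coef0.
  rewrite big_seq sumr_ge0 // => y yL.
  rewrite extract_scal mulr_ge0 ?ler0q ?(L1 _ yL).2 //.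
  exact: extract_psum_ge0.
have e1 : (1 : {poly {poly {poly algC}}}) ^+ 2 = 1 by rewrite expr1n.
have em : (-1 : {poly {poly {poly algC}}}) ^+ 2 = 1 by rewrite sqrrN expr1n.
have := @ribbon_sum_eqJ _ ('X ^+ i) ('X%:P ^+ j) ('X%:P%:P ^+ k) i j k nv x i0 j0 k0 _ _ b.
case=> [||P [Q [W HPQW]]].
- rewrite -(letter_prod odd_i odd_j odd_k prim_i prim_j prim_k e1).
  by apply: eq_bigr => v _; rewrite mul1r.
- rewrite -(letter_prod odd_i odd_j odd_k prim_i prim_j prim_k em).
  by apply: eq_bigr => v _; rewrite mulN1r polyCN mulNr.
have hJ : eqJ ('X ^+ i) ('X%:P ^+ j) ('X%:P%:P ^+ k)
  (ribbon_sum (@letter_asc nv) (@letter_wt _ nv x) b)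
  (ribbon_coefs ('X ^+ i) ('X%:P ^+ j) ('X%:P%:P ^+ k) i j k b) by exists P, Q, W.
move: ge0; rewrite (extract_eqJ prim_i prim_j prim_k hJ).
rewrite /ribbon_coefs (extract_squarefree prim_i prim_j prim_k) ler0z.
have [a0 ha] := andP comp_a.
have sE : steps a = true :: b.
  rewrite /b; case/lastP: a a0 {comp_a L1 L2 sum_ijk RL hJ HPQW b ha} => // a y _.
  by rewrite -cats1 steps_cat.
have -> : (size b).+1 = sumn a by rewrite -size_steps // sE.
have -> : count id b = (size a).-1 by rewrite -count_steps sE.
rewrite sum_ijk eqxx -/b /ind.
(* The extracted coefficient is 8 times the signed [coef3]; it remains to divide by 8. *)
by case/boolP: (odd (size a).-1) => o; rewrite -signr_odd ?o ?(negPf o) /= => h; lia.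
Qed.

(** * Choice of the parts *)

Local Close Scope ring_scope.

Lemma steps_nseq1 c : steps (nseq c 1) = nseq c true.
Proof.
by elim: c => //= c IH; rewrite steps_cons IH /= cats1 -[RHS]/(nseq c.+1 true) -addn1 nseqD cats1.
Qed.

Lemma split_leading_ones a : all (fun x => 0 < x) a -> has (fun x => 1 < x) a ->
  exists y r, 1 < y /\ a = nseq (find (fun x => 1 < x) a) 1 ++ y :: r.
Proof.
elim: a => [|x a IH] //= /andP[x0 pos_a]; case: ltnP => [x1 _|x1 /= h].
  by exists x, a.
have [y [r [y1 aE]]] := IH pos_a h; exists y, r; split => //=.
by rewrite -aE (_ : x = 1) //; lia.
Qed.

Section Ends.
Variable a : seq nat.
Hypotheses (pos_a : all (fun x => 0 < x) a) (has_a : has (fun x => 1 < x) a).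
Let n := sumn a.
Let F y := nth false (steps a) y.

Lemma head_len_lt : head_len a < n.
Proof.
have [y [r [y1 aE]]] := split_leading_ones pos_a has_a.
by rewrite /n aE sumn_cat sumn_nseq /head_len -aE /=; lia.
Qed.

(** The walk ends with the [head_len a - 1] single boxes at the top, each entered by a step up. The
    box before them ends a row with at least two boxes, hence is entered by a step right. *)
Lemma steps_head : 
  (forall p, 0 < p < head_len a -> F (n - p)) /\ F (n - head_len a) = false.
Proof.
have := head_len_lt; rewrite /F /n -(size_steps pos_a).
have [y [r [y1 aE]]] := split_leading_ones pos_a has_a.
rewrite /head_len; set c := find _ a in aE *; rewrite aE.
rewrite steps_cat steps_cons steps_nseq1.
case: y y1 {aE} => [|[|y]] // _; rewrite /= -catA.
set s := steps r; rewrite !size_cat /= !size_nseq => hc.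
split=> [p /andP[p0 lt_p]|].
  rewrite nth_cat ifF; last by lia.
  rewrite (_ : _ - p - size s = (y + (c - p)).+2); last by lia.
  by rewrite /= nth_cat size_nseq ifF ?nth_nseq; [rewrite ifT //|]; lia.
rewrite nth_cat ifF; last by lia.
rewrite (_ : _ - c.+1 - size s = y.+1); last by lia.
by rewrite /= -cat_cons nth_cat /= size_nseq ltnSn -[false :: _]/(nseq y.+1 false) nth_nseq if_same.
Qed.

(** Box [tail_len a] of the walk, counted from 0, is the second box of the lowest row with at least
    two boxes. *)
Lemma steps_tail1 : last 0 a = 1 ->
  (forall p, 0 < p < tail_len a -> F p) /\ F (tail_len a) = false.
Proof.
move=> last1; rewrite /tail_len last1 eqxx.
have [||y [r [y1 aE]]] := @split_leading_ones (rev a); rewrite ?all_rev ?has_rev //.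
set c := find _ _ in aE *.
have {}aE : a = rev r ++ y :: nseq c 1.
  rewrite -[LHS]revK aE rev_cat rev_cons cat_rcons; congr (_ ++ _ :: _).
  apply: (@eq_from_nth _ 0) => [|p]; rewrite size_rev // size_nseq => hp.
  by rewrite nth_rev ?size_nseq // !nth_nseq hp ifT //; lia.
rewrite /F aE steps_cat steps_cons steps_nseq1.
case: y y1 {aE} => [|[|y]] // _; rewrite /= -catA.
split=> [p /andP[p0 lt_p]|].
  rewrite nth_cat size_nseq nth_nseq; case: ifP => [-> //|h].
  by rewrite (_ : p - c = 0) //; lia.
by rewrite nth_cat size_nseq ifF ?subSnn //; lia.
Qed.
End Ends.

Lemma steps_tail a : all (fun x => 0 < x) a -> 1 < size a -> 1 < last 0 a ->
  [/\ last 0 a < sumn a, forall p, 0 < p < last 0 a -> nth false (steps a) p = false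
    & nth false (steps a) (last 0 a)].
Proof.
case/lastP: a => // a m; rewrite last_rcons size_rcons all_rcons -cats1 steps_cat sumn_cat /=.
move=> /andP[m0 pos_a] a0 m1; rewrite /steps /= cats0 -/(steps a).
have sE : exists s, steps a = true :: s.
  case/lastP: a a0 pos_a => // a y _ _; rewrite -cats1 steps_cat /steps /=.
  by eexists.
have [s ->] := sE.
have sum0 : 0 < sumn a.
  by case: a a0 pos_a {sE} => //= y a _ /andP[y0 _]; lia.
split; first by lia.
  by case=> [|p] //= hp; rewrite nth_cat size_nseq nth_nseq if_same ifT //; lia.
by case: m m0 m1 => //= m _ _; rewrite nth_cat size_nseq ltnn subnn.
Qed.

(** A single column is the transpose of a row. Excluding it guarantees a row with at least two
    boxes, so that [find] in the head length does not run off the end. *)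
Lemma all_ones_in_B a : a != [::] -> all (fun x => 0 < x) a ->
  ~~ has (fun x => 1 < x) a -> in_B a.
Proof.
move=> a0 pos_a h.
have aE : a = nseq (size a) 1.
  apply/all_pred1P/allP => x xa; have := allP pos_a x xa; move/hasPn: h => /(_ x xa) /=.
  by lia.
have n0 : 0 < size a by case: (a) a0.
exists (size a); split => //; right; left.
have -> : tri (size a) 1 = [:: size a] by rewrite /tri /= subnK.
rewrite /ribbon_transpose (_ : (_ - _).+1 = size a); last by rewrite /= addn0 subn1 prednK.
rewrite {1}aE; apply: (@eq_from_nth _ 0) => [|p].
  by rewrite size_nseq size_map size_iota.
rewrite size_nseq => hp; rewrite nth_nseq hp (nth_map 0) ?size_iota // nth_iota // add0n.
rewrite /cells /= cats0 /rstart /= count_map.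
have -> : count [pred j | j == p] (iota 0 (size a)) = 1 => //.
by rewrite count_uniq_mem ?iota_uniq // mem_iota hp.
Qed.

(** The parts (1, p - 1, n - p), used below with p = k, m and k + 1, and their pairwise sums. *)
Lemma three_parts p n : odd n -> ~~ odd p -> 1 < p < n ->
  [/\ odd p.-1, odd (n - p) & 1 + p.-1 + (n - p) = n] /\
  [/\ 1 + p.-1 = p, 1 + (n - p) = n - p.-1 & p.-1 + (n - p) = n - 1].
Proof. by move=> on ep /andP[p1 pn]; split; split; lia. Qed.

Theorem mainTheorem17 (a : seq nat) :
  is_composition a -> ~ in_B a ->
  odd (sumn a) -> odd (size a) -> nth 0 a 0 = 1 ->
  ((1 < last 0 a /\ ~~ odd (head_len a)) \/
   (1 < last 0 a /\ odd (head_len a) /\ ~~ odd (tail_len a)) \/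
   (last 0 a = 1 /\ head_len a = tail_len a)) ->
  ~ r_p_positive a.
Proof.
move=> comp_a notB odd_n odd_l a1 cases pos.
have [a0 pos_a] := andP comp_a.
have [has_a|no_a] := boolP (has (fun x => 1 < x) a); last first.
  by apply: notB; apply: all_ones_in_B.
pose c y := ind (nth false (steps a) y).
have bound i j k : odd i -> odd j -> odd k -> i + j + k = sumn a ->
   (0 <= 1 - c i - c j - c k - c (i + j)%N - c (i + k)%N - c (j + k)%N
    + c i * (c (i + j)%N + c (i + k)%N) + c j * (c (i + j)%N + c (j + k)%N)
    + c k * (c (i + k)%N + c (j + k)%N))%R.
  move=> oi oj ok sum_ijk.
  have := p_positive_coef3 comp_a pos oi oj ok sum_ijk.
  rewrite -signr_odd (_ : odd (size a).-1 = false); last by lia.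
  rewrite mul1r /coef3.
  have cE y : cut (behead (steps a)) y = c y.
    rewrite /cut /c; case/lastP: (a) a0 => // a' y' _.
    by rewrite -cats1 steps_cat.
  by rewrite !cE.
have k_lt := head_len_lt pos_a has_a; have [headT headF] := steps_head pos_a has_a.
have k_gt1 : 1 < head_len a by move: a1 {notB}; rewrite /head_len; case: (a) => //= x a' ->.
set n := sumn a in odd_n bound k_lt headT headF *.
set k := head_len a in cases k_lt k_gt1 headT headF *.
have cT y : nth false (steps a) y -> c y = 1%R by rewrite /c => ->.
have cF y : nth false (steps a) y = false -> c y = 0%R by rewrite /c => ->.
have c01 y : c y = 0%R \/ c y = 1%R by rewrite /c; case: (nth _ _ _); [right|left].
have cn1 : c (n - 1) = 1%R by apply: cT; apply: headT.
have ck1 : c (n - k.-1) = 1%R by apply: cT; apply: headT; lia.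
have ck : c (n - k) = 0%R by apply: cF.
have size2 : 1 < last 0 a -> 1 < size a.
  by case: (a) a1 a0 => [|x [|y s]] //= ->.
case: cases => [[last2 even_k]|[[last2 [_ even_m]]|[last1 km]]].
- have [_ tailF tailT] := steps_tail pos_a (size2 last2) last2.
  have c1 : c 1 = 0%R by apply: cF; apply: tailF.
  have [[o1 o2 e1] [e2 e3 e4]] := three_parts odd_n even_k (introT andP (conj k_gt1 k_lt)).
  (* Here F = H = [c k.-1] and G = 2 + [c k]; the value is -1 - [c k] if F = 0 and -1 if F = 1. *)
  have := bound 1 _ _ isT o1 o2 e1; rewrite e2 e3 e4 c1 ck ck1 cn1.
  by case: (c01 k) => ->; case: (c01 k.-1) => ->.
- have [m_lt tailF tailT] := steps_tail pos_a (size2 last2) last2.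
  move: even_m; rewrite /tail_len gtn_eqF //.
  set m := last 0 a in last2 m_lt tailF tailT * => even_m.
  have c1 : c 1 = 0%R by apply: cF; apply: tailF.
  have cm1 : c m.-1 = 0%R by apply: cF; apply: tailF; lia.
  have cm : c m = 1%R by apply: cT.
  have [[o1 o2 e1] [e2 e3 e4]] := three_parts odd_n even_m (introT andP (conj last2 m_lt)).
  (* The same pattern: F = H = [c (n - m)] and G = 2 + [c (n - m.-1)]. *)
  have := bound 1 _ _ isT o1 o2 e1; rewrite e2 e3 e4 c1 cm1 cm cn1.
  by case: (c01 (n - m)) => ->; case: (c01 (n - m.-1)) => ->.
have [tailT tailF] := steps_tail1 pos_a has_a last1.
rewrite -km in tailT tailF.
have c1 : c 1 = 1%R by apply: cT; apply: tailT.
have ck' : c k = 0%R by apply: cF.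
have [odd_k|even_k] := boolP (odd k).
  have even_k1 : ~~ odd k.+1 by rewrite oddS odd_k.
  have k1_lt : k.+1 < n by rewrite ltn_neqAle k_lt andbT; apply: contraL odd_n => /eqP <-.
  have [[o1 o2 e1] [e2 e3 e4]] := three_parts odd_n even_k1 (introT andP (conj (ltnW k_gt1) k1_lt)).
  (* With x = [c (n - k.+1)] and y = [c k.+1]: F = 1 + x, G = 1 + y and H = 1 + x y, so the value is
     -1. *)
  have := bound 1 _ _ isT o1 o2 e1; rewrite e2 e3 e4 -[k.+1.-1]/k c1 ck' cn1 ck.
  by case: (c01 k.+1) => ->; case: (c01 (n - k.+1)) => ->.
have ckm : c k.-1 = 1%R by apply: cT; apply: tailT; lia.
have [[o1 o2 e1] [e2 e3 e4]] := three_parts odd_n even_k (introT andP (conj k_gt1 k_lt)).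
(* All six indicators are known: F = G = H = 2, so the value is -1. *)
by have := bound 1 _ _ isT o1 o2 e1; rewrite e2 e3 e4 c1 ck ck1 cn1 ck' ckm.
Qed.
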